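(* Let $N\geq 1$ and $Q$ be integers with $0\leq Q\leq N$. For $q\in(0,1)$ let $\text{bin}(N;q)$ denote a binomial random variable with $N$ trials and success probability $q$. Then \[\frac{d^2}{dq^2}\sum_{i=Q}^{N}\bigl(1-\Pr\{\text{bin}(N;q)\leq i\}\bigr)\ \geq\ 0\qquad\text{for all } q\in(0,1).\]
   Context: The probability mass function is $\Pr\{\text{bin}(N;q)=k\}=\binom{N}{k}q^k(1-q)^{N-k}$ for $k=0,\ldots,N$. $N$ is the (known) number of customers, $q$ is the probability that each customer makes a purchase, and $Q$ is a fixed order quantity (a nonnegative integer). *)

(* Defs.v *)
(* MathComp / MathComp-Analysis *)
From mathcomp Require Import all_boot all_order all_algebra.
From mathcomp Require Import all_classical all_reals all_analysis.

Set Implicit Arguments.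
Unset Strict Implicit.
Unset Printing Implicit Defensive.

Import Order.TTheory GRing.Theory Num.Theory.
Import numFieldNormedType.Exports.

Local Open Scope classical_set_scope.
Local Open Scope ring_scope.

(* [binomial_prob N q] is the binomial law only for 0 <= q <= 1; outside this
   interval the library sets it to the Dirac mass at 0. Its values are extended
   reals, finite since it is a probability, hence [fine]. *)
Definition binomial_cdf (R : realType) (N : nat) (q : R) (i : nat) : R :=
  fine (binomial_prob N q [set k | (k <= i)%N]).

Definition binomial_tail_sum (R : realType) (N Q : nat) (q : R) : R :=
  \sum_(Q <= i < N.+1) (1 - binomial_cdf N q i).

(* Main.v *)
(* On [0, 1] the sum is a polynomial in q. Writing b n k for the Bernstein
   polynomials, b (n+1) (k+1)' = (n+1) (b n k - b n (k+1)), so telescoping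
   turns the derivative of the cdf at i into - N b (N-1) i, and, for Q >= 1,
   the second derivative of the whole sum into N (N-1) b (N-2) (Q-1) >= 0; for
   Q = 0 the sum is the mean N q, which is linear. *)
Require Import Defs.
From mathcomp Require Import all_boot all_order all_algebra.
From mathcomp Require Import all_classical all_reals all_analysis.
Import Order.TTheory GRing.Theory Num.Theory.
Import numFieldNormedType.Exports.
Local Open Scope ring_scope.

(** Formal polynomials make differentiation algebraic. The truncated [n - k] is harmless: ['C(n, k)]
    vanishes when k > n. *)
Definition bernstein (R : comNzRingType) (n k : nat) : {poly R} :=
  'X^k * (1 - 'X) ^+ (n - k) *+ 'C(n, k).

Lemma bernstein_small (R : comNzRingType) n k :
  (n < k)%N -> bernstein R n k = 0.
Proof. by move=> nk; rewrite /bernstein bin_small. Qed.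

Lemma deriv_bernstein0 (R : comNzRingType) n :
  (bernstein R n.+1 0)^`() = - bernstein R n 0 *+ n.+1.
Proof.
rewrite /bernstein !bin0 !expr0 !mul1r !subn0 !mulr1n.
by rewrite deriv_exp derivB derivX derivC sub0r mulN1r.
Qed.

Lemma deriv_bernsteinS (R : comNzRingType) n k :
  (bernstein R n.+1 k.+1)^`() = (bernstein R n k - bernstein R n k.+1) *+ n.+1.
Proof.
rewrite /bernstein subSS derivMn derivM derivXn deriv_exp derivB derivX derivC.
rewrite sub0r mulN1r -subnS /= mulrnAl mulrnAr mulrN mulNrn mulrnDl mulNrn.
(* Absorption: (k+1) C(n+1,k+1) = (n+1) C(n,k) and (n-k) C(n+1,k+1) = (n+1) C(n,k+1). *)
rewrite mulrnBl -!mulrnA -mul_bin_diag -(subSS k n) -(mul_bin_down n.+1 k.+1).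
by rewrite ![('C(_, _) * _)%N]mulnC.
Qed.

Lemma deriv_sum_bernstein (R : comNzRingType) n i :
  (\sum_(0 <= k < i.+1) bernstein R n.+1 k)^`() = - bernstein R n i *+ n.+1.
Proof.
rewrite raddf_sum /=; elim: i => [|i IHi].
  by rewrite big_nat1 deriv_bernstein0.
by rewrite big_nat_recr//= IHi deriv_bernsteinS -mulrnDl addrA addNr add0r.
Qed.

(** The polynomial that agrees with [binomial_tail_sum] on [0, 1]. *)
Definition tail_sum_poly (R : comNzRingType) (N Q : nat) : {poly R} :=
  \sum_(Q <= i < N.+1) (1 - \sum_(0 <= k < i.+1) bernstein R N k).

Lemma deriv_tail_sum_poly (R : comNzRingType) n Q :
  (tail_sum_poly R n.+1 Q)^`() =
  (\sum_(Q <= i < n.+2) bernstein R n i) *+ n.+1.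
Proof.
rewrite /tail_sum_poly raddf_sum /= -sumrMnl; apply: eq_bigr => i _.
by rewrite derivB derivC sub0r deriv_sum_bernstein mulNrn opprK.
Qed.

Lemma deriv2_tail_sum_poly (R : comNzRingType) n Q : (Q <= n.+2)%N ->
  (tail_sum_poly R n.+2 Q)^`()^`() =
  (if Q is q.+1 then bernstein R n q else 0) *+ (n.+1 * n.+2).
Proof.
move=> Qn; rewrite deriv_tail_sum_poly derivMn mulrnA; congr (_ *+ _).
case: Q Qn => [_|q qn].
  (* For Q = 0 the sum runs over all indices up to n+2, so only a term beyond the degree n is
     left. *)
  by rewrite deriv_sum_bernstein bernstein_small ?oppr0// leqW.
rewrite raddf_sum /= big_add1 /=.
under eq_bigr do rewrite deriv_bernsteinS -opprB.
rewrite sumrMnl; congr (_ *+ _).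
(* The ends of the telescope are b n q and b n (n+2), the latter zero. *)
rewrite sumrN (telescope_sumr (bernstein R n)) ?(ltnW qn)// opprB.
by rewrite (bernstein_small _ n n.+2)// subr0.
Qed.

Lemma horner_bernstein (R : realType) n k (x : R) :
  (bernstein R n k).[x] = binomial_pmf n x k.
Proof.
rewrite /bernstein /binomial_pmf hornerMn hornerM hornerXn horner_exp.
by rewrite hornerD hornerN hornerX hornerC.
Qed.

Lemma binomial_cdfE (R : realType) N (x : R) i : 0 <= x <= 1 ->
  binomial_cdf N x i = (\sum_(0 <= k < i.+1) bernstein R N k).[x].
Proof.
move=> x01; rewrite /binomial_cdf /binomial_prob x01.
have -> : [set k | (k <= i)%N]%classic = `I_i.+1 by [].
rewrite esum_fset//; last by move=> k _; rewrite lee_fin binomial_pmf_ge0.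
rewrite -fsbig_ord sumEFin /= big_mkord horner_sum.
by apply: eq_bigr => k _; rewrite horner_bernstein.
Qed.

Lemma binomial_tail_sumE (R : realType) N Q (x : R) : 0 <= x <= 1 ->
  binomial_tail_sum N Q x = (tail_sum_poly R N Q).[x].
Proof.
move=> x01; rewrite /binomial_tail_sum /tail_sum_poly horner_sum.
by apply: eq_bigr => i _; rewrite binomial_cdfE// hornerD hornerN hornerC.
Qed.

Lemma deriv2_tail_sum_poly_ge0 (R : realType) N Q (x : R) :
  (1 <= N)%N -> (Q <= N)%N -> 0 <= x <= 1 ->
  0 <= (tail_sum_poly R N Q)^`()^`().[x].
Proof.
case: N => [//|[|n]] _ QN x01.
  (* N = 1 is not covered by the closed form: here the first derivative is a sum of constants b 0
     i. *)
  rewrite deriv_tail_sum_poly mulr1n raddf_sum /= horner_sum sumr_ge0// => -[|i] _.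
    by rewrite /bernstein !expr0 mulr1 derivC horner0.
  by rewrite bernstein_small// derivC horner0.
rewrite deriv2_tail_sum_poly// hornerMn mulrn_wge0//.
case: Q {QN} => [|Q]; first by rewrite horner0.
by rewrite horner_bernstein binomial_pmf_ge0.
Qed.

(** Derivability is asserted separately because the derivative operators are total, with a default
    value where the limit does not exist. *)
Theorem theorem3 (R : realType) (N Q : nat) (hN : (1 <= N)%N) (hQ : (Q <= N)%N)
    (q : R) (hq : 0 < q < 1) :
  [/\ derivable (binomial_tail_sum N Q : R -> R) q 1,
      derivable ((binomial_tail_sum N Q : R -> R)^`())%classic q 1 &
      0 <= ((binomial_tail_sum N Q : R -> R)^`(2))%classic q].
Proof.
have near01 (x : R) : 0 < x < 1 -> \forall y \near x, 0 < y < 1.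
  move=> x01; have /near_in_itvoo : x \in `]0, 1[ by rewrite in_itv.
  by apply: filterS => y; rewrite in_itv.
(* The polynomial formula holds on [0, 1] only, so derivatives are transferred through equality near
   interior points. *)
have tailE (x : R) : 0 < x < 1 ->
    \forall y \near x, (tail_sum_poly R N Q).[y] = binomial_tail_sum N Q y.
  move=> /near01; apply: filterS => y /andP[y0 y1].
  by rewrite binomial_tail_sumE// !ltW.
(* The second derivative needs the first ones to agree on a neighbourhood of q, hence [tailE] at
   every nearby y. *)
have dtailE : \forall y \near q,
    (tail_sum_poly R N Q)^`().[y] = (binomial_tail_sum N Q : R -> R)^`()%classic y.
  apply: filterS (near01 q hq) => y y01.
  by rewrite derivE !derive1E; apply: near_eq_derive; exact: tailE.
split.
- by apply: (near_eq_derivable (tailE q hq)); exact: derivable_horner.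
- by apply: (near_eq_derivable dtailE); exact: derivable_horner.
rewrite derive1nS derive1n1 derive1E -(near_eq_derive _ dtailE).
rewrite -derive1E -derivE deriv2_tail_sum_poly_ge0//.
by case/andP: hq => q0 q1; rewrite !ltW.
Qed.
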